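(* Let $\mathcal{X}$ be a nonempty finite set with $N=|\mathcal{X}|$, and let $\{\rho_x\}_{x\in\mathcal{X}}$ be pairwise distinct density operators on a finite-dimensional Hilbert space $\mathcal{H}$ (that is, $\rho_x\ne\rho_{x'}$ whenever $x\neq x'$). For each integer $n\ge1$ let $\mathcal{Q}_n(X\to A)$ be the maximal quantum leakage for $n$ copies of the states. Then $\mathcal{Q}_n(X\to A)$ is non-decreasing in $n$ and $$\lim_{n\to\infty}\mathcal{Q}_n(X\to A)=\log(N).$$
   Context: A density operator is a positive semidefinite operator of unit trace. A POVM on a Hilbert space $\mathcal{K}$ with finite outcome set $\mathcal{Y}$ is a family $\{F_y\}_{y\in\mathcal{Y}}$ of operators on $\mathcal{K}$ with $F_y\ge0$ and $\sum_yF_y=I$. $\log$ is the natural logarithm. The maximal quantum leakage for $n$ copies is $$\mathcal{Q}_n(X\to A)=\log\Big(\max_{\{F_y\}_{y\in\mathcal{Y}}}\sum_{y\in\mathcal{Y}}\max_{x\in\mathcal{X}}\mathrm{Tr}(\rho_x^{\otimes n}F_y)\Big),$$ the maximum being over all POVMs $\{F_y\}_{y\in\mathcal{Y}}$ on the $n$-copy space $\mathcal{H}^{\otimes n}$ with arbitrary finite outcome set $\mathcal{Y}$. *)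

(* Defs.v *)
From mathcomp Require Import all_boot all_order all_algebra.
From mathcomp Require Import complex.
From mathcomp Require mxtens.
From mathcomp Require Import all_classical all_reals all_analysis.
Import Order.TTheory GRing.Theory Num.Theory numFieldNormedType.Exports.

Set Implicit Arguments.
Unset Strict Implicit.
Unset Printing Implicit Defensive.

Local Open Scope classical_set_scope.
Local Open Scope ring_scope.
Local Open Scope complex_scope.
Local Open Scope sesquilinear_scope.

(* The Hilbert space is C^d, with C = R[i], and operators on it are d x d
   complex matrices. *)

(* In the partial order of R[i], 0 <= z says that z is real and nonnegative,
   so this forces A to be Hermitian. *)
Definition psdmx (R : realType) (d : nat) (A : 'M[R[i]]_d) : Prop :=
  forall v : 'cV[R[i]]_d, 0 <= (v ^t* *m A *m v) 0 0.

Definition is_density (R : realType) (d : nat) (rho : 'M[R[i]]_d) : Prop :=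
  psdmx rho /\ \tr rho = 1.

Definition is_povm (R : realType) (d : nat) (Y : finType)
    (F : Y -> 'M[R[i]]_d) : Prop :=
  (forall y, psdmx (F y)) /\ \sum_y F y = 1%:M.

(* n-fold Kronecker power, an operator on the n-th tensor power of C^d *)
Definition tens_power (R : realType) (d : nat) (rho : 'M[R[i]]_d) (n : nat) :
    'M[R[i]]_(d ^ n) :=
  mxtens.ntensmx rho n.

(* The greatest element of a set of reals, and 0 if there is none. *)
Definition maximum (R : realType) (S : set R) : R := xget 0 (S `&` ubound S).

(* The traces are real and nonnegative, so taking real parts loses nothing and
   0 is a harmless initial value for the maximum over a nonempty X. *)
Definition povm_value (R : realType) (d : nat) (X Y : finType)
    (sigma : X -> 'M[R[i]]_d) (F : Y -> 'M[R[i]]_d) : R :=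
  \sum_y \big[Num.max/0]_x complex.Re (\tr (sigma x *m F y)).

Definition max_leakage (R : realType) (d : nat) (X : finType)
    (rho : X -> 'M[R[i]]_d) (n : nat) : R :=
  ln (maximum [set r | exists (Y : finType) (F : Y -> 'M[R[i]]_(d ^ n)),
    is_povm F /\ r = povm_value (fun x => tens_power (rho x) n) F]).

(* Main.v *)
Require Import Defs.
From mathcomp Require Import all_boot all_order all_algebra.
From mathcomp Require Import complex.
From mathcomp Require mxtens.
From mathcomp Require Import all_classical all_reals all_analysis.
From mathcomp Require Import ring lra.
Import Order.TTheory GRing.Theory Num.Theory numFieldNormedType.Exports.

Set Implicit Arguments.
Unset Strict Implicit.
Unset Printing Implicit Defensive.

Local Open Scope classical_set_scope.
Local Open Scope ring_scope.
Local Open Scope complex_scope.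
Local Open Scope sesquilinear_scope.

(** Measuring the copies one by one reduces the lower bound to a classical
    problem: a single-copy POVM under which the states have pairwise distinct
    outcome distributions exists (test projections v v^* / |v|^2, randomised
    over the pairs of states), and for its n-fold product one has
      N - sum_y max_x p_x(y) <= sum_(x <> x') sum_y sqrt (p_x(y) p_x'(y)),
    where each inner sum is the n-th power of a Bhattacharyya coefficient < 1.
    The upper bound N follows from Tr (rho F) >= 0.

    Since [maximum] is 0 when there is no greatest element, attainment matters:
    merging outcomes by the winning x reduces the problem to POVMs indexed by X,
    which form a compact set. Monotonicity comes from replacing F by 1 (x) F. *)

(** * Positive semidefinite matrices, traces and Kronecker products *)

Section PsdMatrices.
Variable R : realType.
Local Notation C := R[i].

Lemma trmxC_mul m n p (A : 'M[C]_(m, n)) (B : 'M[C]_(n, p)) :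
  (A *m B)^t* = B^t* *m A^t*.
Proof. by rewrite trmx_mul map_mxM. Qed.

Lemma qform_delta d (A : 'M[C]_d) (c : C) i j :
  let v : 'cV[C]_d := delta_mx i 0 + c *: delta_mx j 0 in
  (v^t* *m A *m v) 0 0 =
  A i i + c * A i j + Num.conj c * A j i + Num.conj c * c * A j j.
Proof.
rewrite /=.
have E k l : (delta_mx 0 k : 'rV[C]_d) *m A *m (delta_mx l 0 : 'cV[C]_d) = (A k l)%:M.
  by rewrite -rowE -colE; apply/matrixP=> a b; rewrite !ord1 !mxE eqxx mulr1n.
have -> : (delta_mx i 0 + c *: delta_mx j 0 : 'cV[C]_d)^t* =
    delta_mx 0 i + Num.conj c *: delta_mx 0 j.
  apply/matrixP => a b; rewrite !mxE rmorphD rmorphM /= !rmorph_nat.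
  by rewrite andbC (andbC (b == j)).
rewrite mulmxDl !mulmxDr !mulmxDl -!scalemxAr -!scalemxAl !E.
by rewrite !mxE eqxx !mulr1n; ring.
Qed.

(** Polarization on the vectors e_i + c e_j: c = 0 kills the diagonal, then c = 1 and c = i kill
    A_ij + A_ji and A_ij - A_ji. *)
Lemma qform_eq0 d (A : 'M[C]_d) :
  (forall v : 'cV[C]_d, (v^t* *m A *m v) 0 0 = 0) -> A = 0.
Proof.
move=> A0.
have H c i j : A i i + c * A i j + Num.conj c * A j i + Num.conj c * c * A j j = 0.
  by rewrite -qform_delta A0.
have D i : A i i = 0 by have := H 0 i i; rewrite conjC0 !mul0r !addr0.
apply/matrixP=> i j; rewrite mxE.
have := H 1 i j; have := H 'i i j.
rewrite !D conjC1 conjCi !mulr0 !mul1r !add0r !addr0 mulNr -mulrBr => /eqP.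
rewrite mulf_eq0 (negPf (neq0Ci _)) /= subr_eq0 => /eqP <- /eqP.
by rewrite -mulr2n mulrn_eq0 => /eqP.
Qed.

(** The form of the adjoint is the conjugate of the form of A, which is real, so their difference
    has zero quadratic form. *)
Lemma psdmx_herm d (A : 'M[C]_d) : psdmx A -> A^t* = A.
Proof.
move=> A0; apply/eqP; rewrite -subr_eq0; apply/eqP/qform_eq0 => v.
rewrite mulmxBr mulmxBl [LHS]mxE [X in _ + X]mxE; apply/eqP; rewrite subr_eq0.
have -> : v^t* *m A^t* *m v = (v^t* *m A *m v)^t*.
  by rewrite !trmxC_mul trmxCK mulmxA.
by rewrite !mxE; apply/eqP/CrealP/ger0_real; move: (A0 v); rewrite mxE.
Qed.

Lemma psdmx_mulCmx m n (M : 'M[C]_(m, n)) : psdmx (M^t* *m M).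
Proof.
move=> v; rewrite mulmxA -trmxC_mul -mulmxA mxE; apply: sumr_ge0 => k _.
by rewrite !mxE mulrC; exact: mul_conjC_ge0.
Qed.

Lemma psdmxP d (A : 'M[C]_d) : psdmx A -> exists M : 'M[C]_d, A = M^t* *m M.
Proof.
move=> A0; have Aherm := psdmx_herm A0.
have /orthomx_spectralP : A \is normalmx by apply/normalmxP; rewrite Aherm.
set P := spectralmx A; set s := spectral_diag A.
have Pu : P \is unitarymx := spectral_unitarymx A.
rewrite invmx_unitary // => As.
have sE : diag_mx s = P *m A *m P^t*.
  rewrite As !mulmxA (unitarymxP Pu) mul1mx -mulmxA (unitarymxP Pu).
  by rewrite mulmx1.
(* Each eigenvalue is the value of the form at the adjoint of a row of P, so diag(s) has a real
   square root. *)
have s0 k : 0 <= s 0 k.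
  have := A0 ((row k P)^t*); rewrite trmxCK.
  have -> : row k P *m A *m (row k P)^t* = (s 0 k)%:M.
    rewrite -row_mul; apply/matrixP => a b; rewrite !ord1.
    have Pk : (P *m A *m P^t*) k k = s 0 k by rewrite -sE mxE eqxx mulr1n.
    rewrite [RHS]mxE eqxx mulr1n -Pk [LHS]mxE [RHS]mxE.
    by apply: eq_bigr => l _; rewrite !mxE /=.
  by rewrite mxE eqxx mulr1n.
exists (diag_mx (\row_k sqrtC (s 0 k)) *m P).
rewrite {1}As; have -> : diag_mx s = (diag_mx (\row_k sqrtC (s 0 k)))^t* *m
    diag_mx (\row_k sqrtC (s 0 k)).
  rewrite tr_diag_mx map_diag_mx mulmx_diag; congr diag_mx.
  apply/rowP => k; rewrite !mxE /=.
  have /CrealP -> : sqrtC (s 0 k) \is Num.real by rewrite ger0_real ?sqrtC_ge0.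
  by rewrite -expr2 sqrtCK.
by rewrite trmxC_mul !mulmxA.
Qed.

Lemma psdmx_tr_ge0 d (A : 'M[C]_d) : psdmx A -> 0 <= \tr A.
Proof.
move=> A0; apply: sumr_ge0 => i _.
have := A0 (delta_mx i 0 + 0 *: delta_mx i 0).
by rewrite qform_delta conjC0 !mul0r !addr0.
Qed.

(** With A = M^* M and B = K^* K, cyclicity turns the trace into that of L^* L for L = M K^*. *)
Lemma psdmx_tr_mul_ge0 d (A B : 'M[C]_d) :
  psdmx A -> psdmx B -> 0 <= \tr (A *m B).
Proof.
move=> /psdmxP[M ->] /psdmxP[K ->].
rewrite mulmxA mxtrace_mulC !mulmxA -(mulmxA (_ *m _)).
have -> : K *m M^t* *m (M *m K^t*) = (M *m K^t*)^t* *m (M *m K^t*).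
  by rewrite trmxC_mul trmxCK.
exact/psdmx_tr_ge0/psdmx_mulCmx.
Qed.

Lemma psdmxD d (A B : 'M[C]_d) : psdmx A -> psdmx B -> psdmx (A + B).
Proof.
by move=> A0 B0 v; rewrite mulmxDr mulmxDl mxE addr_ge0.
Qed.

Lemma psdmx0 d : psdmx (0 : 'M[C]_d).
Proof. by move=> v; rewrite mulmx0 mul0mx mxE. Qed.

Lemma psdmx1 d : psdmx (1%:M : 'M[C]_d).
Proof.
by have := @psdmx_mulCmx d d 1%:M; rewrite mulmx1 trmx1 map_mx1.
Qed.

Lemma psdmx_sum d (I : Type) (r : seq I) (P : pred I) (F : I -> 'M[C]_d) :
  (forall i, P i -> psdmx (F i)) -> psdmx (\sum_(i <- r | P i) F i).
Proof. by move=> F0; elim/big_ind: _ => //; [exact: psdmx0|exact: psdmxD]. Qed.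

Lemma psdmxZ d (c : C) (A : 'M[C]_d) : 0 <= c -> psdmx A -> psdmx (c *: A).
Proof.
by move=> c0 A0 v; rewrite -scalemxAr -scalemxAl mxE mulr_ge0.
Qed.

Lemma psdmx_tens d e (A : 'M[C]_d) (B : 'M[C]_e) :
  psdmx A -> psdmx B -> psdmx (mxtens.tensmx A B).
Proof.
move=> /psdmxP[M ->] /psdmxP[K ->].
rewrite -mxtens.tensmx_mul -mxtens.map_mxT -mxtens.trmx_tens.
exact: psdmx_mulCmx.
Qed.

Lemma mxtrace_tens d e (A : 'M[C]_d) (B : 'M[C]_e) :
  \tr (mxtens.tensmx A B) = \tr A * \tr B.
Proof. by rewrite mxtens.mulr_sum; apply: eq_bigr => i _; rewrite mxE. Qed.

Lemma tensmxDl m n p q (A B : 'M[C]_(m, n)) (D : 'M[C]_(p, q)) :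
  mxtens.tensmx (A + B) D = mxtens.tensmx A D + mxtens.tensmx B D.
Proof. by apply/matrixP => i j; rewrite !mxE mulrDl. Qed.

Lemma tensmxDr m n p q (A : 'M[C]_(m, n)) (B D : 'M[C]_(p, q)) :
  mxtens.tensmx A (B + D) = mxtens.tensmx A B + mxtens.tensmx A D.
Proof. by apply/matrixP => i j; rewrite !mxE mulrDr. Qed.

Lemma tensmx_suml m n p q (I : finType) (F : I -> 'M[C]_(m, n))
    (D : 'M[C]_(p, q)) :
  mxtens.tensmx (\sum_i F i) D = \sum_i mxtens.tensmx (F i) D.
Proof.
apply: (big_morph (fun A => mxtens.tensmx A D)) => [A B|].
  exact: tensmxDl.
exact: mxtens.tens0mx.
Qed.

Lemma tensmx_sumr m n p q (I : finType) (A : 'M[C]_(m, n))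
    (F : I -> 'M[C]_(p, q)) :
  mxtens.tensmx A (\sum_i F i) = \sum_i mxtens.tensmx A (F i).
Proof.
apply: (big_morph (mxtens.tensmx A)) => [B D|]; first exact: tensmxDr.
exact: mxtens.tensmx0.
Qed.

Lemma tensmx11 d e :
  mxtens.tensmx (1%:M : 'M[C]_d) (1%:M : 'M[C]_e) = 1%:M.
Proof.
apply/matrixP => i j.
case: (mxtens.mxtens_indexP i) => i0 i1; case: (mxtens.mxtens_indexP j) => j0 j1.
rewrite mxtens.tensmxE !mxE (can_eq (@mxtens.mxtens_indexK _ _)) xpair_eqE.
by rewrite -natrM mulnb.
Qed.

(** Positivity of the form at e_i + c e_j for c = 1, -1, i, -i leaves linear constraints on real and
    imaginary parts. This bounds the set of POVMs. *)
Lemma psdmx_entry_bound d (A : 'M[C]_d) i j : psdmx A ->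
  (forall k, complex.Re (A k k) <= 1) ->
  `|complex.Re (A i j)| <= 1 /\ `|complex.Im (A i j)| <= 1.
Proof.
move=> A0 A1.
have H c : 0 <= A i i + c * A i j + Num.conj c * A j i + Num.conj c * c * A j j.
  by rewrite -qform_delta; exact: A0.
have := A1 i; have := A1 j.
have := H 1; have := H (-1); have := H 'i%C; have := H (- 'i%C).
case: (A i i) => a a'; case: (A i j) => b b'; case: (A j i) => c c'.
case: (A j j) => e e' /=.
rewrite -[Num.conj 1]/(1^*)%C -[Num.conj (-1)]/((-1)^*)%C.
rewrite -[Num.conj 'i%C]/(('i%C)^*)%C -[Num.conj (- 'i%C)]/((- 'i%C)^*)%C.
rewrite !lecE /=.
move=> /andP[/eqP h1 h2] /andP[/eqP h3 h4] /andP[/eqP h5 h6] /andP[/eqP h7 h8] h9 h10.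
split; rewrite ler_norml; apply/andP; split; lra.
Qed.

End PsdMatrices.

(** * Compactness of the POVMs indexed by X *)

Section MaximumAttained.
Variables (R : realType) (X : finType) (d : nat).
Local Notation C := R[i].
Local Notation I := (X * 'I_d * 'I_d * bool)%type.
(* Families of matrices indexed by X, in real coordinates, with the product
   topology, for which boxes are compact. *)
Local Notation T := (prod_topology (fun _ : I => R)).

Definition mxfam (g : T) (x : X) : 'M[C]_d :=
  \matrix_(i, j) (g (x, i, j, true) +i* g (x, i, j, false)).

Definition mxfam_coord (F : X -> 'M[C]_d) : T := fun k =>
  let: (x, i, j, b) := k in
  if b then complex.Re (F x i j) else complex.Im (F x i j).

Lemma mxfam_coordK F : mxfam (mxfam_coord F) = F.
Proof.
apply/funext => x; apply/matrixP => i j; rewrite mxE /=.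
by case: (F x i j).
Qed.

(** Stated through the two real components, so that only the topology of [R] is involved. *)
Definition ccontinuous (h : T -> C) :=
  continuous (fun g => complex.Re (h g)) /\
  continuous (fun g => complex.Im (h g)).

Lemma ccontinuous_cst c : ccontinuous (fun=> c).
Proof. by split=> g; exact: cst_continuous. Qed.

Lemma ccontinuousD h k :
  ccontinuous h -> ccontinuous k -> ccontinuous (fun g => h g + k g).
Proof.
move=> [hR hI] [kR kI]; split=> g.
  rewrite (_ : (fun _ => _) = (fun g => complex.Re (h g) + complex.Re (k g))).
    exact: (continuousD (hR g) (kR g)).
  by apply/funext => g'; rewrite raddfD.
rewrite (_ : (fun _ => _) = (fun g => complex.Im (h g) + complex.Im (k g))).
  exact: (continuousD (hI g) (kI g)).
by apply/funext => g'; rewrite raddfD.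
Qed.

Lemma ccontinuousM h k :
  ccontinuous h -> ccontinuous k -> ccontinuous (fun g => h g * k g).
Proof.
move=> [hR hI] [kR kI]; split=> g.
  rewrite (_ : (fun _ => _) = (fun g => complex.Re (h g) * complex.Re (k g) -
      complex.Im (h g) * complex.Im (k g))).
    exact: (continuousB (continuousM (hR g) (kR g))
      (continuousM (hI g) (kI g))).
  by apply/funext => g'; case: (h g') (k g') => [a b] [a' b'].
rewrite (_ : (fun _ => _) = (fun g => complex.Re (h g) * complex.Im (k g) +
    complex.Im (h g) * complex.Re (k g))).
  exact: (continuousD (continuousM (hR g) (kI g))
    (continuousM (hI g) (kR g))).
by apply/funext => g'; case: (h g') (k g') => [a b] [a' b'].
Qed.

Lemma ccontinuous_sum (J : finType) (h : J -> T -> C) :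
  (forall j, ccontinuous (h j)) -> ccontinuous (fun g => \sum_j h j g).
Proof.
move=> hc; elim: (index_enum J) => [|j r IH].
  rewrite (_ : (fun _ => _) = (fun=> 0)); first exact: ccontinuous_cst.
  by apply/funext => g; rewrite big_nil.
rewrite (_ : (fun _ => _) = (fun g => h j g + \sum_(i <- r) h i g)).
  exact: ccontinuousD.
by apply/funext => g; rewrite big_cons.
Qed.

Lemma ccontinuous_mxfam x i j : ccontinuous (fun g => mxfam g x i j).
Proof.
split=> g.
  rewrite (_ : (fun _ => _) = (fun g : T => g (x, i, j, true))).
    exact: (@proj_continuous I (fun=> R) (x, i, j, true) g).
  by apply/funext => g'; rewrite mxE.
rewrite (_ : (fun _ => _) = (fun g : T => g (x, i, j, false))).
  exact: (@proj_continuous I (fun=> R) (x, i, j, false) g).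
by apply/funext => g'; rewrite mxE.
Qed.

Lemma ccontinuous_mulmx m n p (A : T -> 'M[C]_(m, n)) (B : T -> 'M[C]_(n, p)) :
  (forall i j, ccontinuous (fun g => A g i j)) ->
  (forall i j, ccontinuous (fun g => B g i j)) ->
  forall i j, ccontinuous (fun g => (A g *m B g) i j).
Proof.
move=> Ac Bc i j.
rewrite (_ : (fun _ => _) = (fun g => \sum_k A g i k * B g k j)).
  by apply: ccontinuous_sum => k; exact: ccontinuousM.
by apply/funext => g; rewrite mxE.
Qed.

Lemma ccontinuous_closed_ge0 h : ccontinuous h -> closed [set g | 0 <= h g].
Proof.
move=> [hR hI].
rewrite (_ : [set g | _] =
    (fun g => complex.Im (h g)) @^-1` [set x | x = 0] `&`
    (fun g => complex.Re (h g)) @^-1` [set x | 0 <= x]).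
  apply: closedI; apply: preimage_closed; [|exact: closed_eq| |exact: closed_ge].
    by move=> g _; exact: hI.
  by move=> g _; exact: hR.
apply/seteqP; split=> g /=; rewrite lecE /=.
  by case/andP => /eqP.
by move=> [-> ->]; rewrite eqxx.
Qed.

Lemma ccontinuous_closed_eq h c : ccontinuous h -> closed [set g | h g = c].
Proof.
move=> hc.
rewrite (_ : [set g | _] = [set g | 0 <= h g + - c] `&`
    [set g | 0 <= c + -1 * h g]).
  apply: closedI; apply: ccontinuous_closed_ge0; apply: ccontinuousD => //;
    try exact: ccontinuous_cst.
  by apply: ccontinuousM => //; exact: ccontinuous_cst.
apply/seteqP; split=> g /=; rewrite mulN1r !subr_ge0; first by move=> ->.
by move=> [h1 h2]; apply/eqP; rewrite eq_le h1 h2.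
Qed.

(** One closed condition for each test vector and each entry of the sum; closedness survives
    arbitrary intersections. *)
Lemma closed_povm : closed [set g : T | is_povm (mxfam g)].
Proof.
rewrite (_ : [set g | _] =
    \bigcap_(k in [set: X * 'cV[C]_d])
      [set g | 0 <= (k.2^t* *m mxfam g k.1 *m k.2) 0 0] `&`
    \bigcap_(k in [set: 'I_d * 'I_d])
      [set g | \sum_x mxfam g x k.1 k.2 = (1%:M : 'M[C]_d) k.1 k.2]).
  apply: closedI; apply: closed_bigI => -[x v] _ /=.
    apply: ccontinuous_closed_ge0.
    apply: (@ccontinuous_mulmx 1 d 1 (fun g => v^t* *m mxfam g x) (fun=> v)).
      apply: (@ccontinuous_mulmx 1 d d (fun=> v^t*)) => i j.
        exact: ccontinuous_cst.
      exact: ccontinuous_mxfam.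
    by move=> i j; exact: ccontinuous_cst.
  apply: ccontinuous_closed_eq; apply: ccontinuous_sum => y.
  exact: ccontinuous_mxfam.
apply/seteqP; split=> g /=.
  move=> [g0 g1]; split=> [[x v] _|[i j] _] /=; first exact: g0.
  by rewrite -g1 summxE.
move=> [g0 g1]; split=> [x v|]; first exact: (g0 (x, v)).
by apply/matrixP => i j; rewrite summxE; exact: (g1 (i, j)).
Qed.

Lemma povm_diag_le1 (F : X -> 'M[C]_d) x i :
  is_povm F -> complex.Re (F x i i) <= 1.
Proof.
move=> [F0 F1].
have Fd y : 0 <= F y i i.
  have := F0 y (delta_mx i 0 + 0 *: delta_mx i 0).
  by rewrite qform_delta conjC0 !mul0r !addr0.
have : F x i i <= 1.
  have := congr1 (fun A : 'M[C]_d => A i i) F1.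
  rewrite summxE [RHS]mxE eqxx mulr1n => <-; rewrite (bigD1 x) //= lerDl.
  by apply: sumr_ge0.
by rewrite lecE => /andP[].
Qed.

(** A closed subset of the cube [-1, 1]^I, which is compact by Tychonoff. *)
Lemma compact_povm : compact [set g : T | is_povm (mxfam g)].
Proof.
apply: (@subclosed_compact T _ [set g : T | forall k, `[-1, 1]%classic (g k)]).
- exact: closed_povm.
- exact: (@tychonoff I (fun=> R) (fun=> `[-1, 1]%classic)
    (fun=> @segment_compact R (-1) 1)).
move=> g gp [[[x i] j] b] /=.
have [gR gI] := psdmx_entry_bound i j (gp.1 x) (fun k => povm_diag_le1 x k gp).
rewrite !mxE /= in gR gI.
by rewrite in_itv /= -ler_norml; case: b.
Qed.

Lemma sum_tr_povm_max (X0 : X) (sigma : X -> 'M[C]_d) :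
  exists F : X -> 'M[C]_d, is_povm F /\ forall G : X -> 'M[C]_d, is_povm G ->
    \sum_x complex.Re (\tr (sigma x *m G x)) <=
    \sum_x complex.Re (\tr (sigma x *m F x)).
Proof.
pose f (g : T) := complex.Re (\sum_x \tr (sigma x *m mxfam g x)).
have fE (G : X -> 'M[C]_d) :
    \sum_x complex.Re (\tr (sigma x *m G x)) = f (mxfam_coord G).
  by rewrite /f mxfam_coordK raddf_sum.
have [|||g] := @compact_EVT_max T R f [set g : T | is_povm (mxfam g)].
(* The set is nonempty: it contains the POVM that always answers [X0]. *)
- exists (mxfam_coord (fun x => if x == X0 then 1%:M else 0)) => /=.
  rewrite mxfam_coordK; split=> [x|].
    by case: eqP => _; [exact: psdmx1|exact: psdmx0].
  by rewrite -big_mkcond big_pred1_eq.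
- exact: compact_povm.
- apply: continuous_subspaceT.
  suff [] : ccontinuous (fun g => \sum_x \tr (sigma x *m mxfam g x)) by [].
  apply: ccontinuous_sum => x; apply: ccontinuous_sum => i.
  apply: (@ccontinuous_mulmx d d d (fun=> sigma x)) => j k.
    exact: ccontinuous_cst.
  exact: ccontinuous_mxfam.
rewrite inE /= => gp gmax; exists (mxfam g); split=> // G Gp.
rewrite (fE G) -[leRHS]raddf_sum.
by apply: gmax; rewrite inE /= mxfam_coordK.
Qed.

End MaximumAttained.

(** * Attainment, the upper bound N and monotonicity *)

Section Leakage.
Variables (R : realType) (X : finType).
Local Notation C := R[i].

Lemma bigmax_attained (X0 : X) (f : X -> R) : (forall x, 0 <= f x) ->
  exists x, \big[Num.max/0]_x f x = f x /\ forall z, f z <= f x.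
Proof.
move=> f0; have [x _ xmax] := @Order.TotalTheory.arg_maxP _ R X X0 xpredT f isT.
exists x; split=> [|z]; last exact: xmax.
apply/le_anti/andP; split; last exact: le_bigmax.
by apply: bigmax_le => // z _; exact: xmax.
Qed.

Lemma Re_tr_mul_ge0 d (A B : 'M[C]_d) : psdmx A -> psdmx B ->
  0 <= complex.Re (\tr (A *m B)).
Proof. by move=> A0 B0; have := psdmx_tr_mul_ge0 A0 B0; rewrite lecE => /andP[]. Qed.

(** The first trace is real, so taking real parts is multiplicative here. *)
Lemma Re_psdmx_trM d (A B : 'M[C]_d) e (D E : 'M[C]_e) : psdmx A -> psdmx B ->
  complex.Re (\tr (A *m B) * \tr (D *m E)) =
  complex.Re (\tr (A *m B)) * complex.Re (\tr (D *m E)).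
Proof.
move=> A0 B0; have := psdmx_tr_mul_ge0 A0 B0; rewrite lecE => /andP[/eqP + _].
case: (\tr (A *m B)) (\tr (D *m E)) => a a' [b b'] /= ->.
by rewrite mul0r subr0.
Qed.

Lemma Re_tr_mulmx_sum d (Y : finType) (P : pred Y) (A : 'M[C]_d)
    (F : Y -> 'M[C]_d) :
  complex.Re (\tr (A *m \sum_(y | P y) F y)) =
  \sum_(y | P y) complex.Re (\tr (A *m F y)).
Proof.
rewrite mulmx_sumr (raddf_sum (@mxtrace C d)).
by rewrite (raddf_sum (@complex.Re R)).
Qed.

Lemma sum_Re_tr_povm d (Y : finType) (A : 'M[C]_d) (F : Y -> 'M[C]_d) :
  \sum_y F y = 1%:M ->
  \sum_y complex.Re (\tr (A *m F y)) = complex.Re (\tr A).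
Proof. by move=> F1; rewrite -Re_tr_mulmx_sum F1 mulmx1. Qed.

Lemma le_povm_value_diag d (sigma F : X -> 'M[C]_d) :
  \sum_x complex.Re (\tr (sigma x *m F x)) <= povm_value sigma F.
Proof.
apply: ler_sum => x _.
exact: (@le_bigmax _ _ _ _ (fun z => complex.Re (\tr (sigma z *m F x)))).
Qed.

(* Merging all the outcomes on which the same x wins does not change the value. *)
Lemma povm_value_coarse (X0 : X) d (Y : finType) (sigma : X -> 'M[C]_d)
    (F : Y -> 'M[C]_d) :
  (forall x, psdmx (sigma x)) -> is_povm F ->
  exists G : X -> 'M[C]_d, is_povm G /\
    povm_value sigma F = \sum_x complex.Re (\tr (sigma x *m G x)).
Proof.
move=> s0 [F0 F1].
have /choice[a aP] y := bigmax_attained X0 (fun x => Re_tr_mul_ge0 (s0 x) (F0 y)).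
exists (fun x => \sum_(y | a y == x) F y); split.
  split=> [x|]; first by apply: psdmx_sum.
  by rewrite -F1 [RHS](partition_big a xpredT).
rewrite /povm_value (partition_big a xpredT) //=.
apply: eq_bigr => x _; rewrite Re_tr_mulmx_sum.
by apply: eq_bigr => y /eqP <-; exact: (aP y).1.
Qed.

(** Merging outcomes bounds every value by the linear functional at some POVM on X. That functional
    never exceeds the value of the same POVM, so its maximizer is optimal among all POVMs. *)
Lemma povm_value_max (X0 : X) d (sigma : X -> 'M[C]_d) :
  (forall x, psdmx (sigma x)) ->
  exists F : X -> 'M[C]_d, is_povm F /\
    forall (Y : finType) (G : Y -> 'M[C]_d), is_povm G ->
      povm_value sigma G <= povm_value sigma F.
Proof.
move=> s0; have [F [Fp Fmax]] := sum_tr_povm_max X0 sigma.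
exists F; split=> // Y G Gp.
have [H [Hp ->]] := povm_value_coarse X0 s0 Gp.
exact: le_trans (Fmax _ Hp) (le_povm_value_diag _ _).
Qed.

(** A maximum of nonnegative terms is at most their sum; after exchanging the sums each state
    contributes its trace 1. *)
Lemma povm_value_le_card d (Y : finType) (sigma : X -> 'M[C]_d)
    (F : Y -> 'M[C]_d) :
  (forall x, is_density (sigma x)) -> is_povm F -> povm_value sigma F <= #|X|%:R.
Proof.
move=> sd [F0 F1].
have tr0 x y := Re_tr_mul_ge0 (sd x).1 (F0 y).
apply: (@le_trans _ _ (\sum_y \sum_x complex.Re (\tr (sigma x *m F y)))).
  apply: ler_sum => y _; apply: bigmax_le => [|x _]; first exact: sumr_ge0.
  by rewrite (bigD1 x) //= lerDl sumr_ge0.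
rewrite exchange_big /= (eq_bigr (fun=> 1)) => [|x _].
  by rewrite sumr_const.
by rewrite sum_Re_tr_povm // (sd x).2.
Qed.

Lemma tens_power_density d (rho : 'M[C]_d) n :
  is_density rho -> is_density (tens_power rho n.+1).
Proof.
move=> rd; rewrite /tens_power; elim: n => [//|n [IH0 IH1]].
rewrite mxtens.ntensmxSS; split; first exact: psdmx_tens rd.1 IH0.
by rewrite mxtrace_tens rd.2 IH1 mulr1.
Qed.

(** Attainment ensures that [maximum] returns the true optimum and not its default 0. *)
Lemma max_leakageP (X0 : X) d (rho : X -> 'M[C]_d) n :
  (forall x, psdmx (tens_power (rho x) n)) ->
  exists F : X -> 'M[C]_(d ^ n),
    [/\ is_povm F,
        max_leakage rho n = ln (povm_value (fun x => tens_power (rho x) n) F) &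
        forall (Y : finType) (G : Y -> 'M[C]_(d ^ n)), is_povm G ->
          povm_value (fun x => tens_power (rho x) n) G <=
          povm_value (fun x => tens_power (rho x) n) F].
Proof.
move=> s0; have [F [Fp Fmax]] := povm_value_max X0 s0.
exists F; split=> //; congr ln; rewrite /maximum.
set sg := (fun x => _) in Fmax *.
set S := [set r | _].
have SF : S (povm_value sg F) by exists X, F.
have uF : ubound S (povm_value sg F) by move=> _ [Y [G [Gp ->]]]; exact: Fmax.
have [Sx ux] : (S `&` ubound S) (xget 0 (S `&` ubound S)).
  by apply: xgetPex; exists (povm_value sg F).
by apply/le_anti/andP; split; [exact: uF|exact: ux].
Qed.

(** Always answering [X0] scores at least 1. This keeps the arguments of [ln] positive. *)
Lemma povm_value_ge1 (X0 : X) d (sigma : X -> 'M[C]_d) :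
  is_density (sigma X0) ->
  exists F : X -> 'M[C]_d, is_povm F /\ 1 <= povm_value sigma F.
Proof.
move=> [_ s1]; exists (fun x => if x == X0 then 1%:M else 0); split.
  split=> [x|]; first by case: eqP => _; [exact: psdmx1|exact: psdmx0].
  by rewrite -big_mkcond big_pred1_eq.
apply: le_trans (le_povm_value_diag _ _).
rewrite (bigD1 X0) //= eqxx mulmx1 s1 /= big1 ?addr0 // => x /negPf ->.
by rewrite mulmx0 raddf0.
Qed.

Lemma max_leakage_leS (X0 : X) d (rho : X -> 'M[C]_d) n :
  (forall x, is_density (rho x)) ->
  max_leakage rho n.+1 <= max_leakage rho n.+2.
Proof.
move=> rd.
have td x k : is_density (tens_power (rho x) k.+1) by exact: tens_power_density.
have [F [Fp -> Fmax]] := max_leakageP X0 (fun x => (td x n).1).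
have [G [Gp -> Gmax]] := max_leakageP X0 (fun x => (td x n.+1).1).
have [H [Hp H1]] :=
  @povm_value_ge1 X0 _ (fun x => tens_power (rho x) n.+1) (td X0 n).
have F1 := le_trans H1 (Fmax _ _ Hp).
(* The additional copy is left unmeasured and contributes only a factor of trace 1. *)
pose F' x : 'M[C]_(d ^ n.+2) := mxtens.tensmx (1%:M : 'M[C]_d) (F x).
have F'p : is_povm F'.
  split=> [x|]; first exact: psdmx_tens (@psdmx1 _ _) (Fp.1 x).
  by rewrite -tensmx_sumr Fp.2 tensmx11.
suff FF' : povm_value (fun x => tens_power (rho x) n.+1) F =
    povm_value (fun x => tens_power (rho x) n.+2) F'.
  have le1 := Gmax _ _ F'p; rewrite -FF' in le1.
  by rewrite ler_ln // posrE; [|apply: lt_le_trans le1]; exact: lt_le_trans F1.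
apply: eq_bigr => y _; apply: eq_bigr => x _.
rewrite [in RHS]/tens_power mxtens.ntensmxSS mxtens.tensmx_mul mxtrace_tens.
by rewrite mulmx1 (rd x).2 mul1r.
Qed.

End Leakage.

(** * Measurements that separate the states *)

Section Discrimination.
Variables (R : realType) (d : nat).
Local Notation C := R[i].

(** A - B has a nonzero form at some v, and Q is the orthogonal projection onto the line of v. Both
    Q and 1 - Q are Hermitian idempotents, hence positive. *)
Lemma separating_effect (A B : 'M[C]_d) : A <> B ->
  exists Q : 'M[C]_d,
    [/\ psdmx Q, psdmx (1%:M - Q) & \tr (A *m Q) != \tr (B *m Q)].
Proof.
move=> AB.
have [v vP] : exists v : 'cV[C]_d, (v^t* *m (A - B) *m v) 0 0 != 0.
  apply: contrapT => /forallNP H; apply: AB; apply/eqP; rewrite -subr_eq0.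
  by apply/eqP/qform_eq0 => v; apply/eqP; apply: contra_notT (H v).
pose c := (v^t* *m v) 0 0.
have vv : v^t* *m v = c%:M by exact: mx11_scalar.
have c0 : 0 <= c.
  by have := psdmx1 (R := R) (d := d) v; rewrite mulmx1.
have cN0 : c != 0.
  apply: contra_neq vP => c00.
  suff -> : v = 0 by rewrite mulmx0 mxE.
  apply/colP => i; rewrite mxE; apply/eqP; rewrite -normr_eq0 -sqrf_eq0.
  have /eqP := c00; rewrite /c mxE psumr_eq0 => [/allP/(_ i)|j _].
    rewrite mem_index_enum => /(_ isT) /=.
    by rewrite !mxE mulrC -normCK.
  by rewrite !mxE mulrC -normCK exprn_ge0.
pose Q := c^-1 *: (v *m v^t*).
have QH : Q^t* = Q.
  rewrite /Q linearZ /= map_mxZ trmxC_mul trmxCK /=.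
  by have /CrealP -> : c^-1 \is Num.real by rewrite ger0_real // invr_ge0.
have QQ : Q *m Q = Q.
  rewrite /Q -scalemxAl -scalemxAr mulmxA -(mulmxA v) vv mul_mx_scalar.
  by rewrite -scalemxAl !scalerA mulVf // mulr1.
have trQ (D : 'M[C]_d) : \tr (D *m Q) = c^-1 * (v^t* *m D *m v) 0 0.
  rewrite /Q -scalemxAr mxtraceZ mulmxA mxtrace_mulC mulmxA.
  by rewrite trace_mx11.
exists Q; split.
- by rewrite -QQ -{1}QH; exact: psdmx_mulCmx.
- have PH : (1%:M - Q)^t* = 1%:M - Q.
    rewrite -[in RHS]QH; apply/matrixP => i j.
    by rewrite !mxE rmorphB /= rmorph_nat eq_sym.
  have -> : 1%:M - Q = (1%:M - Q)^t* *m (1%:M - Q).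
    rewrite PH mulmxBl mul1mx mulmxBr mulmx1 QQ.
    by rewrite subrr subr0.
  exact: psdmx_mulCmx.
- rewrite -subr_eq0 !trQ -mulrBr mulf_neq0 ?invr_neq0 //.
  by rewrite mulmxBr mulmxBl !mxE in vP *.
Qed.

(* One of the pairwise tests, chosen uniformly at random, is performed and the
   pair is reported together with the result. *)
Lemma separating_povm (X : finType) (X0 : X) (rho : X -> 'M[C]_d) :
  (forall x, psdmx (rho x)) -> injective rho ->
  exists (Z : finType) (E : Z -> 'M[C]_d), is_povm E /\
    forall x x', x != x' -> exists z,
      complex.Re (\tr (rho x *m E z)) != complex.Re (\tr (rho x' *m E z)).
Proof.
move=> r0 rI.
have /choice[Q QP] : forall k : X * X, exists Q : 'M[C]_d,
    [/\ psdmx Q, psdmx (1%:M - Q) &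
        k.1 != k.2 -> \tr (rho k.1 *m Q) != \tr (rho k.2 *m Q)].
  move=> [x x'] /=; have [->|/eqP xx'] := eqVneq x x'.
    (* Diagonal pairs get a dummy test, so that all of [X * X] can index the POVM. *)
    by exists 0; split=> //; [exact: psdmx0|rewrite subr0; exact: psdmx1].
  have [Q [Q0 Q1 QS]] := separating_effect (contra_not (@rI _ _) xx').
  by exists Q; split.
pose c : C := (#|{: X * X}|%:R)^-1.
have N0 : (#|{: X * X}|%:R : C) != 0.
  by rewrite pnatr_eq0 -lt0n; apply/card_gt0P; exists (X0, X0).
have c0 : 0 <= c by rewrite invr_ge0.
pose E (z : X * X * bool) := c *: (if z.2 then Q z.1 else 1%:M - Q z.1).
have Ep : is_povm E.
  split=> [[k b]|].
    by apply: psdmxZ => //=; case: b; have [] := QP k.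
  rewrite /E -scaler_sumr -(pair_bigA _ (fun k (b : bool) =>
    if b then Q k else 1%:M - Q k)) /=.
  rewrite (eq_bigr (fun=> 1%:M)) => [|k _]; last first.
    by rewrite big_bool /= addrC subrK.
  by rewrite sumr_const -scaler_nat scalerA mulVf // scale1r.
exists _, E; split=> // x x' xx'; exists (x, x', true).
have [_ _ /(_ xx') /= QS] := QP (x, x').
have : \tr (rho x *m E (x, x', true)) != \tr (rho x' *m E (x, x', true)).
  rewrite /E /= -!scalemxAr !mxtraceZ -subr_eq0 -mulrBr mulf_neq0 //.
    exact: invr_neq0.
  by rewrite subr_eq0.
(* Both traces are real, so equal real parts would make them equal. *)
apply: contra_neq.
have := psdmx_tr_mul_ge0 (r0 x) (Ep.1 (x, x', true)).
have := psdmx_tr_mul_ge0 (r0 x') (Ep.1 (x, x', true)).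
case: (\tr _) => a a'; case: (\tr _) => b b'.
by rewrite !lecE /= => /andP[/eqP -> _] /andP[/eqP -> _] ->.
Qed.

(* The Bhattacharyya coefficient is multiplicative under independent repetition. *)
Lemma product_povm (X Z : finType) (rho : X -> 'M[C]_d) (E : Z -> 'M[C]_d) n :
  (forall x, psdmx (rho x)) -> is_povm E ->
  exists (Y : finType) (F : Y -> 'M[C]_(d ^ n.+1)), is_povm F /\
    forall x x',
      \sum_y Num.sqrt (complex.Re (\tr (tens_power (rho x) n.+1 *m F y)) *
                       complex.Re (\tr (tens_power (rho x') n.+1 *m F y))) =
      (\sum_z Num.sqrt (complex.Re (\tr (rho x *m E z)) *
                        complex.Re (\tr (rho x' *m E z)))) ^+ n.+1.
Proof.
move=> r0 [E0 E1]; elim: n => [|n [Y [F [[F0 F1] FB]]]].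
  by exists Z, E; split=> // x x'; rewrite expr1.
exists (Z * Y)%type, (fun k => mxtens.tensmx (E k.1) (F k.2)); split.
  split=> [[z y]|]; first exact: psdmx_tens (E0 z) (F0 y).
  rewrite -(pair_bigA _ (fun z y => mxtens.tensmx (E z) (F y))) /=.
  rewrite (eq_bigr (fun z => mxtens.tensmx (E z) 1%:M)) => [|z _].
    by rewrite -tensmx_suml E1 tensmx11.
  by rewrite -tensmx_sumr F1.
move=> x x'; rewrite exprS -FB big_distrlr /=.
rewrite (pair_bigA _ (fun z y => _ * _)) /=; apply: eq_bigr => -[z y] _ /=.
rewrite [tens_power _ n.+2]/tens_power [X in _ * complex.Re (\tr (X *m _))]/tens_power.
rewrite !mxtens.ntensmxSS !mxtens.tensmx_mul !mxtrace_tens.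
(* Probabilities factor over the first copy and the rest, and so does the square root of their
   product. *)
rewrite !(Re_psdmx_trM _ _ (r0 _) (E0 _)) mulrACA sqrtrM //.
by rewrite mulr_ge0 // Re_tr_mul_ge0.
Qed.

End Discrimination.

(** * Bhattacharyya estimates for nonnegative functions *)

Section Classical.
Variable R : realType.

(** The sum of (sqrt p - sqrt q)^2 equals 2 minus twice the coefficient, and it is positive once p
    and q differ somewhere. *)
Lemma bhattacharyya_lt1 (Z : finType) (p q : Z -> R) :
  (forall z, 0 <= p z) -> (forall z, 0 <= q z) ->
  \sum_z p z = 1 -> \sum_z q z = 1 -> (exists z, p z != q z) ->
  \sum_z Num.sqrt (p z * q z) < 1.
Proof.
move=> p0 q0 p1 q1 [z0 pq].
have : 0 < \sum_z (Num.sqrt (p z) - Num.sqrt (q z)) ^+ 2.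
  rewrite (bigD1 z0) //= ltr_wpDr ?sumr_ge0 // => [z _|]; first exact: sqr_ge0.
  rewrite exprn_even_gt0 //= subr_eq0; apply: contra_neq pq => /(congr1 (fun t => t ^+ 2)).
  by rewrite !sqr_sqrtr.
rewrite (eq_bigr (fun z => p z + q z - 2 * Num.sqrt (p z * q z))) => [|z _].
  by rewrite sumrB big_split /= p1 q1 -mulr_sumr; lra.
by rewrite sqrrB !sqr_sqrtr // sqrtrM // mulr_natl; ring.
Qed.

(** If x attains the maximum, then f z <= sqrt (f x * f z) for every other z, and these roots are
    among the terms of the double sum. *)
Lemma sum_le_bigmax_sqrt (X : finType) (X0 : X) (f : X -> R) :
  (forall x, 0 <= f x) ->
  \sum_x f x <= \big[Num.max/0]_x f x +
    \sum_x \sum_(x' | x' != x) Num.sqrt (f x * f x').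
Proof.
move=> f0; have [x [-> xmax]] := bigmax_attained X0 f0.
rewrite (bigD1 x) //= lerD2l [leRHS](bigD1 x) //= ler_wpDr //.
  by do 2![apply: sumr_ge0 => ? _]; exact: sqrtr_ge0.
apply: ler_sum => z _; rewrite -{1}(sqr_sqrtr (f0 z)) sqrtrM // expr2.
by rewrite ler_wpM2r ?sqrtr_ge0 // ler_wsqrtr.
Qed.

End Classical.

(** * Two-sided bounds and convergence to log N *)

Lemma cvg_sum0 (R : realType) (I : finType) (P : pred I) (u : I -> nat -> R) :
  (forall i, P i -> u i n @[n --> \oo] --> (0 : R)) ->
  \sum_(i | P i) u i n @[n --> \oo] --> (0 : R).
Proof.
move=> u0; have E : \sum_(i | P i) 0 = 0 :> R by rewrite big1.
rewrite -[X in _ --> X]E.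
by apply: cvg_big => //; exact: add_continuous.
Qed.

(** Here b collects the Bhattacharyya coefficients of one single-copy POVM, chosen independently of
    n, and v is the optimal value for n+1 copies. *)
Lemma max_leakage_lower (R : realType) (X : finType) (X0 : X) d
    (rho : X -> 'M[R[i]]_d) :
  (forall x, is_density (rho x)) -> injective rho ->
  exists b : X -> X -> R, (forall x x', x' != x -> `|b x x'| < 1) /\
    forall n, exists v : R,
      [/\ max_leakage rho n.+1 = ln v, v <= #|X|%:R &
          #|X|%:R - \sum_x \sum_(x' | x' != x) b x x' ^+ n.+1 <= v].
Proof.
move=> rd rI; have r0 x := (rd x).1.
have [Z [E [Ep ES]]] := separating_povm X0 r0 rI.
exists (fun x x' => \sum_z Num.sqrt (complex.Re (\tr (rho x *m E z)) *
                                     complex.Re (\tr (rho x' *m E z)))); split.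
  move=> x x' xx'; rewrite ger0_norm; last first.
    by apply: sumr_ge0 => z _; exact: sqrtr_ge0.
  apply: bhattacharyya_lt1.
  - by move=> z; exact: Re_tr_mul_ge0 (r0 x) (Ep.1 z).
  - by move=> z; exact: Re_tr_mul_ge0 (r0 x') (Ep.1 z).
  - by rewrite sum_Re_tr_povm ?Ep.2 // (rd x).2.
  - by rewrite sum_Re_tr_povm ?Ep.2 // (rd x').2.
  - by apply: ES; rewrite eq_sym.
move=> n; have td x := tens_power_density n (rd x).
have [F [Fp FE Fmax]] := max_leakageP X0 (fun x => (td x).1).
exists (povm_value (fun x => tens_power (rho x) n.+1) F); split=> //.
  exact: povm_value_le_card.
have [Y [G [Gp GB]]] := product_povm n r0 Ep.
apply: le_trans (Fmax _ _ Gp); rewrite lerBlDr.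
under eq_bigr => x _ do under eq_bigr => x' _ do rewrite -GB.
pose p x y := complex.Re (\tr (tens_power (rho x) n.+1 *m G y)).
(* Writing N as total probability lets the inequality be checked outcome by outcome. *)
have -> : #|X|%:R = \sum_y \sum_x p x y.
  rewrite exchange_big /= (eq_bigr (fun=> 1)) => [|x _].
    by rewrite sumr_const.
  by rewrite sum_Re_tr_povm ?Gp.2 // (td x).2.
rewrite (eq_bigr (fun x => \sum_y \sum_(x' | x' != x)
  Num.sqrt (p x y * p x' y))) => [|x _]; last by rewrite exchange_big.
rewrite [X in _ + X]exchange_big -big_split /=; apply: ler_sum => y _.
by apply: sum_le_bigmax_sqrt => // x; exact: Re_tr_mul_ge0 (td x).1 (Gp.1 y).
Qed.

Theorem mainTheorem4 (R : realType) (d : nat) (X : finType)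
    (X_nonempty : (0 < #|X|)%N) (rho : X -> 'M[R[i]]_d)
    (rho_density : forall x, is_density (rho x))
    (rho_distinct : forall x x', x <> x' -> rho x <> rho x') :
  (forall m n : nat, (1 <= m)%N -> (m <= n)%N ->
     max_leakage rho m <= max_leakage rho n) /\
  max_leakage rho n @[n --> \oo] --> ln (#|X|%:R : R).
Proof.
have [X0 _] := card_gt0P X_nonempty.
split.
  move=> [//|m] n _; elim: n => [//|n IH].
  rewrite leq_eqVlt => /predU1P[-> //|]; rewrite ltnS => mn.
  (* The one-step inequality starts at one copy; n = 0 is excluded by m < n. *)
  apply: le_trans (IH mn) _; case: n mn {IH} => [//|n _].
  exact: (max_leakage_leS X0).
have rI : injective rho.
  by move=> x x' E; apply: contrapT => /rho_distinct.
have [b [b1 bP]] := max_leakage_lower X0 rho_density rI.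
have /choice[v vP] := bP.
(* The shift drops the term at n = 0, since the bounds start at one copy. *)
rewrite -cvg_shiftS (_ : (fun n => _) = (fun n => ln (v n))); last first.
  by apply/funext => n; have [] := vP n.
(* As N > 0, continuity of [ln] at N leaves the convergence of v to N, which follows by
   squeezing. *)
apply: continuous_cvg; first by apply: continuous_ln; rewrite ltr0n.
apply: (@squeeze_cvgr _ _ _ _
  (fun n => #|X|%:R - \sum_x \sum_(x' | x' != x) b x x' ^+ n.+1) (fun=> #|X|%:R)).
- by apply: nearW => n; have [_ -> ->] := vP n.
- rewrite -[X in _ --> X]subr0; apply: cvgB; first exact: cvg_cst.
  apply: cvg_sum0 => x _; apply: cvg_sum0 => x' xx'.
  by rewrite (cvg_shiftS (fun n => b x x' ^+ n)); apply/cvg_expr/b1.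
- exact: cvg_cst.
Qed.
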